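(* Let $G$ be a countable amenable group and let $(F_n)_{n\ge1}$ be a strongly tempered Følner sequence in $G$. For any real numbers $\alpha<\beta$ and any $S>0$, there exist $0<c_0<1$ and $c_1>0$ such that for every measure preserving system $(X,\mathscr{B},\mu,(T_g)_{g\in G})$ and every $f\in L^\infty_\mu(X)$ with $\|f\|_\infty\le S$, one has $$\mu(D_N)\le c_1c_0^N\qquad\text{for all } N\in\mathbb{N},$$ where $D_N=D_{(F_n),f,\alpha,\beta,N}$ is the set of $x\in X$ for which the sequence of ergodic averages $(\mathsf{A}_nf(x))_{n\ge1}$ along $(F_n)$ fluctuates across $(\alpha,\beta)$ at least $N$ times.
   Context: A measure preserving system (m.p.s.) $(X,\mathscr{B},\mu,(T_g)_{g\in G})$ is a measure preserving action of $G$ on a probability space, with $T_gT_h=T_{gh}$. A (left) Følner sequence in $G$ is a sequence $(F_n)$ of finite nonempty subsets of $G$ with $|gF_n\triangle F_n|/|F_n|\to0$ for every $g\in G$; ''Følner sequence'' without further qualification means left Følner sequence. The ergodic averages of a function $f$ on $X$ along $(F_n)$ are $\mathsf{A}_nf=\frac{1}{|F_n|}\sum_{g\in F_n}f\circ T_g$. A real sequence $(a_n)$ fluctuates $N$ times across a gap $(\alpha,\beta)$ if there are integers $n_1<n_2<\dots<n_{2N}$ such that $a_{n_i}\le\alpha$ for odd $i$ and $a_{n_i}\ge\beta$ for even $i$. A sequence $(F_n)$ of finite subsets of $G$ is left $c$-tempered if $\left|\bigcup_{i<n}F_i^{-1}F_n\right|\le c|F_n|$ for all $n$; right $c$-tempered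 if $\left|\bigcup_{i<n}F_nF_i^{-1}\right|\le c|F_n|$ for all $n$; and $c$-bi-tempered if it is both left and right $c$-tempered. The sequence is strongly tempered if for every $c>1$ some tail $(F_n)_{n>n_0}$ of it is $c$-bi-tempered (the unions in the definition then being taken only over indices $n_0<i<n$). *)

(* Defs.v *)
From HB Require Import structures.
From mathcomp Require Import all_boot all_order all_algebra finmap.
From mathcomp Require Import all_classical all_reals all_analysis.

Set Implicit Arguments.
Unset Strict Implicit.
Unset Printing Implicit Defensive.

Import Order.TTheory GRing.Theory Num.Theory.
Import numFieldNormedType.Exports.

Local Open Scope classical_set_scope.
Local Open Scope ring_scope.

Definition fset_mulg (G : groupType) (A B : {fset G}) : {fset G} :=
  [fset (x * y)%g | x in A, y in B]%fset.

Definition fset_invg (G : groupType) (A : {fset G}) : {fset G} :=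
  [fset (x^-1)%g | x in A]%fset.

Definition fset_symdiff (G : groupType) (A B : {fset G}) : {fset G} :=
  ((A `\` B) `|` (B `\` A))%fset.

(* Sequences are indexed by nat from 0: [F n] is the (n+1)-st term. *)
Definition left_folner (R : realType) (G : groupType) (F : nat -> {fset G}) :
    Prop :=
  (forall n, F n != fset0) /\
  (forall g : G,
    (#|` fset_symdiff (fset_mulg [fset g]%fset (F n)) (F n)|%:R
       / #|` F n|%:R : R) @[n --> \oo] --> (0 : R)).

Definition amenable (R : realType) (G : groupType) : Prop :=
  exists F : nat -> {fset G}, left_folner R F.

Definition left_tempered (R : realType) (G : groupType) (c : R)
    (F : nat -> {fset G}) : Prop :=
  forall n, #|` \big[fsetU/fset0]_(i < n) fset_mulg (fset_invg (F i)) (F n)|%:R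
            <= c * #|` F n|%:R.

Definition right_tempered (R : realType) (G : groupType) (c : R)
    (F : nat -> {fset G}) : Prop :=
  forall n, #|` \big[fsetU/fset0]_(i < n) fset_mulg (F n) (fset_invg (F i))|%:R
            <= c * #|` F n|%:R.

Definition bi_tempered (R : realType) (G : groupType) (c : R)
    (F : nat -> {fset G}) : Prop :=
  left_tempered c F /\ right_tempered c F.

(* The tail [fun k => F (n0 + k)] consists of the terms strictly beyond the
   n0-th one when the sequence is counted from 1. *)
Definition strongly_tempered (R : realType) (G : groupType)
    (F : nat -> {fset G}) : Prop :=
  forall c : R, 1 < c -> exists n0, bi_tempered c (fun k => F (n0 + k)%N).

Record mp_system (R : realType) (G : groupType) (d : measure_display)
    (X : measurableType d) (mu : probability X R) (T : G -> X -> X) : Prop := {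
  mp_action1 : forall x, T 1%g x = x ;
  mp_actionM : forall g h x, T g (T h x) = T (g * h)%g x ;
  mp_measurable : forall g, measurable_fun [set: X] (T g) ;
  mp_preserving : forall g (A : set X), measurable A -> mu (T g @^-1` A) = mu A
}.

Definition ergodic_avg (R : realType) (G : groupType) (X : Type)
    (F : nat -> {fset G}) (T : G -> X -> X) (f : X -> R) (n : nat) (x : X) : R :=
  (\sum_(g <- F n) f (T g x)) / #|` F n|%:R.

(* Only the values n_1, ..., n_{2N} of [n] are used. *)
Definition fluctuates (R : realType) (a : nat -> R) (alpha beta : R) (N : nat) :
    Prop :=
  exists n : nat -> nat,
    (forall i j, (0 < i)%N -> (i < j)%N -> (j <= 2 * N)%N -> (n i < n j)%N) /\
    (forall i, (0 < i <= 2 * N)%N ->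
       if odd i then a (n i) <= alpha else beta <= a (n i)).

Definition fluctuation_set (R : realType) (G : groupType) (X : Type)
    (F : nat -> {fset G}) (T : G -> X -> X) (f : X -> R) (alpha beta : R)
    (N : nat) : set X :=
  [set x | fluctuates (fun n => ergodic_avg F T f n x) alpha beta N].

(* Main.v *)
Require Import Defs.
From HB Require Import structures.
From mathcomp Require Import all_boot all_order all_algebra finmap.
From mathcomp Require Import all_classical all_reals all_analysis.
From mathcomp Require Import measurable_realfun ess_sup_inf ring lra zify.
Import Order.TTheory GRing.Theory Num.Theory.
Local Open Scope classical_set_scope.
Local Open Scope ring_scope.

Set Implicit Arguments.
Unset Strict Implicit.
Unset Printing Implicit Defensive.

(* By transference along [x |-> (g |-> f (T_g x))] it is enough to bound, for a
   bounded [phi] on the group, the finite sets [W] of points at which the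
   averages over the translates [F_m h], [m < n], cross the gap [k] times. With
   [A_n] the union of the [F_i], [i < n], the claim proved by induction on [k] is
   [|W| <= theta_k |A_n W|]; bi-temperedness makes this usable, since both
   [A_n^-1 F_n] and [F_n A_n^-1] are hardly larger than [F_n].

   If [W] has [r] more crossings, select greedily, from large scales to small
   ones, almost disjoint translates [F_m h] at low (resp. high) scales of points
   of [W]. A point of [W] not absorbed by the selection sees, at each of its many
   scales [n], a fixed proportion of pieces of scale [n] or [n+1], so that there
   are few such points. Hence the selection has union [U] in [A_n W] with
   [|W| <= (1 + small) theta_k |U|]. The average of [phi] is at most about
   [alpha] on the low union and at least about [beta] on the high one, and [phi]
   is bounded, so they cannot both nearly fill [A_n W]: [theta] decreases by a
   fixed factor. *)

(** * Products and translates of finite sets *)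

Section Translates.
Variable G : groupType.
Implicit Types (A B C : {fset G}) (g h u : G) (F : nat -> {fset G}).
Local Open Scope group_scope.
Local Open Scope fset_scope.

Definition rtrans A h : {fset G} := [fset x * h | x in A].

Lemma in_rtrans A h u : (u \in rtrans A h) = (u * h^-1 \in A).
Proof.
apply/imfsetP/idP => [[x /= xA ->]|uA]; first by rewrite mulgK.
by exists (u * h^-1); rewrite //= mulgVK.
Qed.

Lemma card_rtrans A h : #|` rtrans A h| = #|` A|.
Proof. by rewrite card_imfset//; exact: mulIg. Qed.

Lemma fset_mulgP A B u :
  reflect (exists a b, [/\ a \in A, b \in B & u = a * b])
          (u \in fset_mulg A B).
Proof.
apply: (iffP (imfset2P _ _ _ _ _)) => [[a aA [b bB ->]]|[a [b [aA bB ->]]]].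
  by exists a, b.
by exists a => //; exists b.
Qed.

Lemma in_fset_mulg A B g h : g \in A -> h \in B -> g * h \in fset_mulg A B.
Proof. by move=> gA hB; apply/fset_mulgP; exists g, h. Qed.

Lemma in_fset_invg A u : (u \in fset_invg A) = (u^-1 \in A).
Proof.
apply/imfsetP/idP => [[x /= xA ->]|uA]; first by rewrite invgK.
by exists u^-1; rewrite //= invgK.
Qed.

Lemma card_fset_invg A : #|` fset_invg A| = #|` A|.
Proof. by rewrite card_imfset//; exact: invg_inj. Qed.

Lemma sum_rtrans (R : nmodType) A h (f : G -> R) :
  (\sum_(u <- rtrans A h) f u = \sum_(g <- A) f (g * h)%g)%R.
Proof. by rewrite big_imfset//= => x y _ _; exact: mulIg. Qed.

Definition past (F : nat -> {fset G}) n : {fset G} :=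
  \big[fsetU/fset0]_(i < n) F i.

Lemma in_past F n g : reflect (exists2 i, (i < n)%N & g \in F i) (g \in past F n).
Proof.
apply: (iffP (bigfcupP _ _ _ _)) => [[i _ gi]|[i ltin gi]]; first by exists i.
by exists (Ordinal ltin); rewrite //= mem_index_enum.
Qed.

Lemma past_sub F m n : (m <= n)%N -> past F m `<=` past F n.
Proof.
move=> mn; apply/fsubsetP => g /in_past[i im gi]; apply/in_past.
by exists i => //; exact: leq_trans mn.
Qed.

Lemma left_tempered_past F n :
  \big[fsetU/fset0]_(i < n) fset_mulg (fset_invg (F i)) (F n)
  = fset_mulg (fset_invg (past F n)) (F n).
Proof.
apply/fsetP => u; apply/idP/idP.
  case/bigfcupP => i _ /fset_mulgP[a [b [aF bF ->]]].
  rewrite in_fset_mulg// in_fset_invg; apply/in_past; exists i => //.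
  by rewrite -in_fset_invg.
case/fset_mulgP => a [b [+ bF ->]]; rewrite in_fset_invg => /in_past[i ltin aF].
apply/bigfcupP; exists (Ordinal ltin); rewrite ?mem_index_enum//.
by rewrite in_fset_mulg// in_fset_invg.
Qed.

Lemma right_tempered_past F n :
  \big[fsetU/fset0]_(i < n) fset_mulg (F n) (fset_invg (F i))
  = fset_mulg (F n) (fset_invg (past F n)).
Proof.
apply/fsetP => u; apply/idP/idP.
  case/bigfcupP => i _ /fset_mulgP[b [a [bF aF ->]]].
  rewrite in_fset_mulg// in_fset_invg; apply/in_past; exists i => //.
  by rewrite -in_fset_invg.
case/fset_mulgP => b [a [bF + ->]]; rewrite in_fset_invg => /in_past[i ltin aF].
apply/bigfcupP; exists (Ordinal ltin); rewrite ?mem_index_enum//.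
by rewrite in_fset_mulg// in_fset_invg.
Qed.

End Translates.

(** * Cardinalities of finite sets as elements of an ordered field *)

Section Counting.
Variable R : realFieldType.
Local Open Scope fset_scope.
Local Notation card A := (#|` A|%:R : R)%R.

Lemma sum1_fset (T : choiceType) (A : {fset T}) : (\sum_(x <- A) (1 : R) = card A)%R.
Proof. by rewrite card_fset_sum1 natr_sum. Qed.

Lemma card_fset_sep (T : choiceType) (A : {fset T}) (P : pred T) :
  card [fset x in A | P x] = (\sum_(x <- A) (P x)%:R)%R.
Proof.
rewrite -sum1_fset big_fset /= big_mkcond; apply: eq_bigr => x _.
by case: (P x).
Qed.

Lemma le_card_fset (T : choiceType) (A B : {fset T}) :
  A `<=` B -> (card A <= card B)%R.
Proof. by move=> AB; rewrite ler_nat fsubset_leq_card. Qed.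

Lemma le_card_inj (T T' : choiceType) (f : T -> T') (A : {fset T})
    (B : {fset T'}) :
  injective f -> (forall x, x \in A -> f x \in B) -> (card A <= card B)%R.
Proof.
move=> fI fAB; have <- : #|` f @` A| = #|` A| by rewrite card_imfset.
rewrite le_card_fset//.
by apply/fsubsetP => _ /imfsetP[x xA ->]; exact: fAB.
Qed.

Lemma card_bigfcup_le (T : choiceType) (I : eqType) (r : seq I) (P : pred I)
    (B : I -> {fset T}) :
  (card (\bigcup_(i <- r | P i) B i) <= \sum_(i <- r | P i) card (B i))%R.
Proof.
elim/big_rec2: _ => [|i x A _ le]; first by rewrite cardfs0.
apply: le_trans (lerD (lexx _) le).
by rewrite -natrD ler_nat; exact: (leq_card_fsetU _ _).1.
Qed.

End Counting.

(** * Consequences of temperedness *)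

Section Tempered.
Variables (R : realFieldType) (G : groupType) (F : nat -> {fset G}) (e : R).
Local Open Scope fset_scope.
Local Notation card A := (#|` A|%:R : R)%R.
Hypothesis F_neq0 : forall n, F n != fset0.
Hypothesis tempL :
  forall n, (card (fset_mulg (fset_invg (past F n)) (F n)) <= (1 + e) * card (F n))%R.
Hypothesis tempR :
  forall n, (card (fset_mulg (F n) (fset_invg (past F n))) <= (1 + e) * card (F n))%R.

Lemma card_F_gt0 n : (0 < card (F n))%R.
Proof. by rewrite ltr0n cardfs_gt0. Qed.

(** [F n a^-1] and [F n b^-1] both lie in [F n (past F n)^-1], which exceeds each of them by at most
    [e * card (F n)] points. *)
Lemma right_shift n (a b : G) : a \in past F n -> b \in past F n ->
  (card [fset g in F n | (g * a^-1 * b)%g \notin F n] <= e * card (F n))%R.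
Proof.
move=> an bn; set P := fset_mulg (F n) (fset_invg (past F n)).
have FP x : x \in past F n -> rtrans (F n) x^-1 `<=` P.
  move=> xn; apply/fsubsetP => u; rewrite in_rtrans invgK => uF.
  by rewrite -(mulgK x u) in_fset_mulg// in_fset_invg invgK.
have : (card [fset g in F n | (g * a^-1 * b)%g \notin F n]
        <= card (P `\` rtrans (F n) b^-1))%R.
  apply: (@le_card_inj R _ _ (fun g => g * a^-1)%g) => [|g]; first exact: mulIg.
  rewrite !inE /= in_rtrans invgK => /andP[gF ->] /=.
  by apply: (fsubsetP (FP _ an)); rewrite in_rtrans invgK mulgVK.
move=> /le_trans; apply; rewrite cardfsDS ?FP// natrB; last first.
  by rewrite fsubset_leq_card ?FP.
by rewrite card_rtrans; have := tempR n; rewrite -/P; lra.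
Qed.

Lemma left_shift n (a b : G) : a \in past F n -> b \in past F n ->
  (card [fset u in F n | (a * b^-1 * u)%g \notin F n] <= e * card (F n))%R.
Proof.
move=> an bn; set Q := fset_mulg (fset_invg (past F n)) (F n).
have cardl x : #|` [fset (x^-1 * u)%g | u in F n]| = #|` F n|.
  by rewrite card_imfset//; exact: mulgI.
have FQ x : x \in past F n -> [fset (x^-1 * u)%g | u in F n] `<=` Q.
  move=> xn; apply/fsubsetP => _ /imfsetP[u /= uF ->].
  by rewrite in_fset_mulg// in_fset_invg invgK.
have : (card [fset u in F n | (a * b^-1 * u)%g \notin F n]
        <= card (Q `\` [fset (a^-1 * u)%g | u in F n]))%R.
  apply: (@le_card_inj R _ _ (fun u => b^-1 * u)%g) => [|u]; first exact: mulgI.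
  rewrite !inE /= => /andP[uF abu]; rewrite in_fset_mulg ?in_fset_invg ?invgK//.
  rewrite andbT; apply: contra abu => /imfsetP[v /= vF buv].
  by rewrite -mulgA buv mulVKg.
move=> /le_trans; apply; rewrite cardfsDS ?FQ// natrB; last first.
  by rewrite fsubset_leq_card ?FQ.
by rewrite cardl; have := tempL n; rewrite -/Q; lra.
Qed.

(** The condition puts [W] inside [(F n)^-1 u], and [z |-> u * z^-1] carries [past F n W] into
    [F n (past F n)^-1]. *)
Lemma card_past_fiber n (u : G) (W : {fset G}) :
  (forall h, h \in W -> u \in rtrans (F n) h) ->
  (card (fset_mulg (past F n) W) <= (1 + e) * card (F n))%R.
Proof.
move=> WF; apply: le_trans (tempR n).
apply: (@le_card_inj R _ _ (fun z => u * z^-1)%g) => [x y /mulgI/invg_inj//|z].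
move=> /fset_mulgP[a [h [an hW ->]]]; rewrite invgM mulgA in_fset_mulg//.
  by rewrite -in_rtrans WF.
by rewrite in_fset_invg invgK.
Qed.

Variable b : G.
Hypothesis b_F0 : b \in F 0%N.

Lemma b_past n : (0 < n)%N -> b \in past F n.
Proof. by move=> n0; apply/in_past; exists 0%N. Qed.

(* [F m] itself is only invariant under each element of [past F m] separately;
   trimming it by means of the single scale [m.-1] makes the set of all [h] such
   that some [F n h], [n < m.-1], meets it invariant simultaneously under all
   scales below [m.-1] (see [past_shadow]). *)
Definition core m : {fset G} :=
  [fset u in F m | (card (F m.-1) <=
     2 * card [fset g in F m.-1 | (g * b^-1 * u)%g \in F m])%R].

Lemma core_sub m : core m `<=` F m.
Proof. by apply/fsubsetP => u; rewrite !inE => /andP[]. Qed.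

(** Double counting of the pairs [(g, u)] with [g * b^-1 * u] outside [F m]: by [left_shift] each
    [g] in [F m.-1] is in at most [e * card (F m)] of them, while each [u] outside the core is
    paired with at least half of [F m.-1]. *)
Lemma card_coreD m : (0 < m)%N ->
  (card (F m `\` core m) <= 2 * e * card (F m))%R.
Proof.
move=> m0.
have F1 := card_F_gt0 m.-1.
have h1 u : u \in F m `\` core m ->
    (card (F m.-1) <= 2 * card [fset g in F m.-1 | (g * b^-1 * u)%g \notin F m])%R.
  rewrite !inE => /andP[+ uF]; rewrite uF /= -ltNge => lt.
  have : card (F m.-1) = (card [fset g in F m.-1 | (g * b^-1 * u)%g \in F m]
       + card [fset g in F m.-1 | (g * b^-1 * u)%g \notin F m])%R.
    by rewrite -!sum1_fset; exact: big_fsetID.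
  by lra.
have : (card (F m `\` core m) * card (F m.-1) <=
   2 * \sum_(u <- F m) card [fset g in F m.-1 | (g * b^-1 * u)%g \notin F m])%R.
  rewrite -sum1_fset mulr_suml mulr_sumr.
  under eq_bigr do rewrite mul1r.
  apply: (@le_trans _ _ (\sum_(u <- F m `\` core m)
     (2 * card [fset g in F m.-1 | (g * b^-1 * u)%g \notin F m]))%R).
    by rewrite big_seq [leRHS]big_seq; apply: ler_sum => u; exact: h1.
  rewrite [leRHS](big_fsetID _ (fun u => u \notin core m)) /=.
  have -> : [fset x in F m | x \notin core m] = F m `\` core m.
    by apply/fsetP => u; rewrite !inE andbC.
  by rewrite lerDl sumr_ge0// => *; rewrite mulr_ge0.
have -> : (\sum_(u <- F m) card [fset g in F m.-1 | (g * b^-1 * u)%g \notin F m]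
   = \sum_(g <- F m.-1) card [fset u in F m | (g * b^-1 * u)%g \notin F m])%R.
  under eq_bigr do rewrite card_fset_sep.
  by rewrite exchange_big; under [RHS]eq_bigr do rewrite card_fset_sep.
have : (\sum_(g <- F m.-1) card [fset u in F m | (g * b^-1 * u)%g \notin F m]
   <= \sum_(g <- F m.-1) (1 * (e * card (F m))))%R.
  rewrite big_seq [leRHS]big_seq; apply: ler_sum => g gF; rewrite mul1r.
  apply: left_shift; last exact: b_past.
  by apply/in_past; exists m.-1; rewrite // prednK.
rewrite -mulr_suml sum1_fset => le1 le2.
by rewrite -(ler_pM2r F1); lra.
Qed.

Definition shadow m : {fset G} := fset_mulg (fset_invg (past F m.-1)) (core m).

Lemma shadow_sub m : shadow m `<=` fset_mulg (fset_invg (past F m)) (F m).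
Proof.
apply/fsubsetP => _ /fset_mulgP[a [u [ap uc ->]]]; rewrite in_fset_mulg//.
  rewrite in_fset_invg; apply: (fsubsetP (past_sub _ (leq_pred m))).
  by rewrite -in_fset_invg.
exact: (fsubsetP (core_sub m)).
Qed.

Lemma in_shadow n m (h h' g : G) : (n < m.-1)%N -> g \in F n ->
  (g * h)%g \in rtrans (core m) h' -> h \in rtrans (shadow m) h'.
Proof.
move=> nm gF; rewrite !in_rtrans -mulgA => gh.
rewrite -[X in X \in _](mulKg g) in_fset_mulg// in_fset_invg invgK.
by apply/in_past; exists n.
Qed.

Hypothesis e_small : (4 * e < 1)%R.

(* If [a, a'] lie in the past of [m.-1], then [F m.-1 b^-1 a a'^-1] and
   [F m.-1 b^-1] almost coincide, so some [g] of [F m.-1] sends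
   [b^-1 a a'^-1 u] into [F m] as soon as [u] is in the core. *)
Lemma past_shadow m (z : G) : z \in fset_mulg (past F m.-1) (shadow m) ->
  (b^-1 * z)%g \in fset_mulg (fset_invg (past F m)) (F m).
Proof.
move=> /fset_mulgP[a [_ [ap /fset_mulgP[a' [u [+ uc ->]]] ->]]].
rewrite in_fset_invg => a'p.
have m1 : (0 < m.-1)%N by case/in_past: ap => i im _; exact: leq_ltn_trans im.
have bp := b_past m1.
set c := (a'^-1)%g in a'p.
suff [g gF gu] : exists2 g, g \in F m.-1 & (g * (b^-1 * (a * (a' * u))))%g \in F m.
  rewrite -[X in X \in _](mulKg g) in_fset_mulg// in_fset_invg invgK.
  apply/in_past; exists m.-1 => //; rewrite ltn_predL; exact: leq_trans (leq_pred m).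
have := uc; rewrite !inE => /andP[uF].
set A := [fset g in F m.-1 | (g * b^-1 * u)%g \in F m] => Age.
pose B1 := [fset g in F m.-1 | (g * b^-1 * c)%g \notin F m.-1].
pose B2 := [fset g in F m.-1 | (g * a^-1 * b)%g \notin F m.-1].
have B1e : (card B1 <= e * card (F m.-1))%R by exact: right_shift.
have B2e : (card B2 <= e * card (F m.-1))%R by exact: right_shift.
have F1 := card_F_gt0 m.-1.
(* [A] is at least half of [F m.-1], and the two exceptional sets together at most [2 * e < 1 / 2]
   of it. For [g] in [A] outside them, right multiplication by [b^-1 * c] and then by [a^-1 * b]
   stays in [F m.-1]. *)
have [/fsubsetP AB|/fsubsetPn[g gA]] :=
    boolP (A `<=` B1 `|` rtrans B2 (c^-1 * b)%g).
  have : (card A <= card B1 + card B2)%R.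
    rewrite -(card_rtrans B2 (c^-1 * b)%g) -natrD ler_nat.
    apply: leq_trans (leq_card_fsetU _ _).1; apply: fsubset_leq_card.
    exact/fsubsetP.
  have : (4 * (e * card (F m.-1)) < card (F m.-1))%R.
    by rewrite mulrA -[ltRHS]mul1r ltr_pM2r.
  by rewrite -/A in Age *; lra.
rewrite in_fsetU negb_or in_rtrans invgM invgK mulgA.
move: gA; rewrite /A /B1 /B2 !inE /= => /andP[gF gu].
rewrite gF /= negbK => /andP[g1 ]; rewrite g1 /= negbK => g2.
exists (g * b^-1 * c * a^-1 * b)%g => //.
suff -> : (g * b^-1 * c * a^-1 * b * (b^-1 * (a * (a' * u))) = g * b^-1 * u)%g by [].
by rewrite !mulgA mulgK mulgVK /c mulgVK.
Qed.

(** By [past_shadow], left translation by [b^-1] and right translation by [h^-1] carry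
    [past F m.-1 W] into [(past F m)^-1 F m], to which left temperedness applies. *)
Lemma card_past_shadow m (h : G) (W : {fset G}) :
  (forall x, x \in W -> x \in rtrans (shadow m) h) ->
  (card (fset_mulg (past F m.-1) W) <= (1 + e) * card (F m))%R.
Proof.
move=> Wsh; apply: le_trans (tempL m).
apply: (@le_card_inj R _ _ (fun z => b^-1 * z * h^-1)%g) => [x y /mulIg/mulgI//|z].
move=> /fset_mulgP[a [x [ap xW ->]]]; rewrite -mulgA past_shadow// -mulgA.
by rewrite in_fset_mulg// -in_rtrans Wsh.
Qed.

End Tempered.

(** * Greedy selection and covering *)

Section Greedy.
Variable R : realFieldType.
Local Open Scope fset_scope.
Local Notation card A := (#|` A|%:R : R)%R.

Lemma sum_fset_sub (T : choiceType) (A B : {fset T}) (f : T -> R) : A `<=` B ->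
  (\sum_(u <- B) f u = \sum_(u <- A) f u + \sum_(u <- B `\` A) f u)%R.
Proof.
move=> /fsubsetP AB; rewrite (big_fsetID _ (mem A)) /=.
congr (_ + _)%R; apply: eq_fbigl => u; rewrite !inE /=; last by rewrite andbC.
by rewrite andb_idl//; exact: AB.
Qed.

Lemma norm_sum_fset_le (T : choiceType) (A : {fset T}) (f : T -> R) (S : R) :
  (forall u, `|f u| <= S)%R -> (`|\sum_(u <- A) f u| <= S * card A)%R.
Proof.
move=> fS; apply: le_trans (ler_norm_sum _ _ _) _.
rewrite -sum1_fset mulr_sumr; apply: ler_sum => u _; by rewrite mulr1.
Qed.

Lemma mem_rcons_self (I : eqType) (r : seq I) (p : I) : p \in rcons r p.
Proof. by rewrite mem_rcons mem_head. Qed.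

(** The list is scanned by decreasing [s], and [p] is kept exactly when the [C q] already kept cover
    less than a proportion [e] of [B p]. A kept [p] adds at least [(1 - e - d) * card (B p)] new
    points, on which the sum of [psi] differs from that over [B p] by at most
    [S * (e + d) * card (B p)]. *)
Lemma greedy_selection (T : choiceType) (I : eqType) (B C : I -> {fset T})
    (s : I -> nat) (psi : T -> R) (e d eta S : R) (r : seq I) :
  (0 <= e)%R -> (e + d <= 1)%R -> (0 <= S)%R -> (forall u, `|psi u| <= S)%R ->
  pairwise (fun p q => s q <= s p)%N r ->
  (forall p, p \in r -> [/\ C p `<=` B p,
     (card (B p `\` C p) <= d * card (B p))%R &
     (\sum_(u <- B p) psi u <= eta * card (B p))%R]) ->
  exists J : seq I, [/\ {subset J <= r},
    ((1 - e - d) * \sum_(p <- J) card (B p) <= card (\bigcup_(p <- J) C p))%R,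
    (forall p, p \in r -> (e * card (B p) <=
       card (B p `&` \bigcup_(q <- J | (s p <= s q)%N) C q))%R) &
    (\sum_(u <- \bigcup_(p <- J) C p) psi u <=
       (eta + S * (e + d)) * \sum_(p <- J) card (B p))%R].
Proof.
move=> e0 ed S0 psiS; elim/last_ind: r => [_ _|r p IH].
  exists [::]; split => //; first by rewrite !big_nil cardfs0 mulr0.
  by rewrite !big_nil mulr0 ?big_seq_fset0.
rewrite pairwise_rcons => /andP[/allP rp rs] BC.
have [p' p'r|J [Jr JU Je Jpsi]] := IH rs; first by apply: BC; rewrite mem_rcons in_cons p'r orbT.
have [Cp Bd Bpsi] := BC p (mem_rcons_self r p).
set U := \bigcup_(q <- J) C q in JU Jpsi.
have all_s q : q \in J -> (s p <= s q)%N by move=> /Jr/rp.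
have [le|lt] := leP (e * card (B p))%R (card (B p `&` U)).
  exists J; split => //.
    by move=> q /Jr; rewrite mem_rcons in_cons orbC => ->.
  move=> q; rewrite mem_rcons in_cons => /predU1P[->|]; last exact: Je.
  apply: le_trans le _; apply: le_card_fset; rewrite fsetIS//.
  by apply/bigfcupsP => i iJ _; apply: bigfcup_sup => //; exact: all_s.
have UE : \bigcup_(q <- rcons J p) C q = U `|` C p.
  by rewrite -cats1 big_cat /= big_seq1.
set N := C p `\` U.
have NB : N `<=` B p by exact: fsubset_trans (fsubsetDl _ _) Cp.
have BN : (card (B p `\` N) <= (e + d) * card (B p))%R.
  have : (card (B p `\` N) <= card ((B p `\` C p) `|` (B p `&` U)))%R.
    apply: le_card_fset; apply/fsubsetP => u; rewrite !inE negb_and negbK.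
    by case: (u \in U); case: (u \in C p); case: (u \in B p).
  move=> /le_trans; apply.
  apply: (@le_trans _ _ (card (B p `\` C p) + card (B p `&` U))%R); last lra.
  by rewrite -natrD ler_nat; exact: (leq_card_fsetU _ _).1.
have NE : (card (B p) = card N + card (B p `\` N))%R.
  by rewrite -!sum1_fset -sum_fset_sub.
have UN : (U `|` C p) `\` U = N.
  by apply/fsetP => u; rewrite /N !inE; case: (u \in U).
have Usub : U `<=` U `|` C p by exact: fsubsetUl.
have UNE : (card (U `|` C p) = card U + card N)%R.
  by rewrite -!sum1_fset (sum_fset_sub _ Usub) UN.
have B0 : (0 <= card (B p))%R by [].
have sumE : (\sum_(i <- rcons J p) card (B i) = \sum_(i <- J) card (B i) + card (B p))%R.
  by rewrite -cats1 big_cat /= big_seq1.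
exists (rcons J p); split.
- move=> q; rewrite !mem_rcons !in_cons => /predU1P[->|/Jr ->]; by rewrite ?eqxx ?orbT.
- by rewrite UE UNE sumE; lra.
- move=> q; rewrite mem_rcons in_cons => /predU1P[->|qr].
    (* A kept [B p] is covered by its own [C p] in proportion at least [1 - d >= e]. *)
    apply: (@le_trans _ _ (card (C p))).
      have -> : (card (B p) = card (C p) + card (B p `\` C p))%R.
        by rewrite -!sum1_fset -sum_fset_sub.
      have C0 : (0 <= card (C p))%R by [].
      have : (card (B p) = card (C p) + card (B p `\` C p))%R.
        by rewrite -!sum1_fset -sum_fset_sub.
      nra.
    apply: le_card_fset; rewrite fsubsetI Cp /=.
    by apply: bigfcup_sup; rewrite ?leqnn// mem_rcons in_cons eqxx.
  apply: le_trans (Je q qr) _; apply: le_card_fset; rewrite fsetIS//.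
  apply/bigfcupsP => i iJ si; apply: bigfcup_sup => //.
  by rewrite mem_rcons in_cons iJ orbT.
- rewrite UE sumE (sum_fset_sub _ Usub) UN.
  have := sum_fset_sub psi NB.
  have := norm_sum_fset_le (B p `\` N) psiS; rewrite ler_norml => /andP[h _].
  have : (S * card (B p `\` N) <= S * ((e + d) * card (B p)))%R by exact: ler_wpM2l.
  lra.
Qed.

End Greedy.

Section Covering.
Variables (R : realFieldType) (G : groupType) (F : nat -> {fset G}) (e : R).
Local Open Scope fset_scope.
Local Notation card A := (#|` A|%:R : R)%R.
Hypothesis F_neq0 : forall n, F n != fset0.
Hypothesis tempL :
  forall n, (card (fset_mulg (fset_invg (past F n)) (F n)) <= (1 + e) * card (F n))%R.
Hypothesis tempR :
  forall n, (card (fset_mulg (F n) (fset_invg (past F n))) <= (1 + e) * card (F n))%R.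
Variable b : G.
Hypothesis b_F0 : b \in F 0%N.
Hypothesis e_gt0 : (0 < e)%R.
Hypothesis e_small : (4 * e < 1)%R.

Lemma ltn_pred_of_neq (m n : nat) : (n <= m)%N -> ~~ ((m == n) || (m == n.+1)) ->
  (n < m.-1)%N.
Proof. lia. Qed.

Lemma sum_eq_le1 (m n0 : nat) (f : nat -> nat) : injective f ->
  (\sum_(n < n0) (m == f n) <= 1)%N.
Proof.
move=> fI; have [n mn|none] := pickP (fun n : 'I_n0 => m == f n); last first.
  by rewrite big1// => n _; rewrite none.
rewrite (bigD1 n)//= mn big1// => k; rewrite (eqP mn) eq_sym.
by apply: contraNeq; rewrite eqb0 negbK => /eqP/fI/val_inj ->.
Qed.

(* A candidate [(h, n)] stands for the translate [F n h]. The last two hypotheses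
   bound [W] on the sets where points get absorbed: the fibres
   [{h | u \in F n h}] and the shadows of the candidates. *)
Lemma covering (W : {fset G}) (n0 : nat) (cand : nat -> G -> bool)
    (theta eta S : R) (psi : G -> R) :
  (0 <= theta)%R -> (0 <= eta)%R -> (0 <= S)%R -> (forall u, `|psi u| <= S)%R ->
  (forall h, h \in W -> 2 <= e ^+ 2 * \sum_(n < n0) (cand n h)%:R)%R ->
  (forall h n, h \in W -> cand n h ->
     (0 < n)%N /\ (\sum_(u <- rtrans (F n) h) psi u <= eta * card (F n))%R) ->
  (forall n (W' : {fset G}), W' `<=` W -> (forall h, h \in W' -> cand n h) ->
     card W' <= theta * card (fset_mulg (past F n) W'))%R ->
  (forall h n (W' : {fset G}), h \in W -> cand n h -> W' `<=` W ->
     (forall x, x \in W' -> x \in rtrans (shadow R F b n) h) ->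
     card W' <= theta * card (fset_mulg (past F n.-1) W'))%R ->
  exists U : {fset G}, [/\ U `<=` fset_mulg (past F n0) W,
    ((1 - 3 * e) * card W <= theta * (1 + e) ^+ 2 * card U)%R &
    ((1 - 3 * e) * (\sum_(u <- U) psi u) <= (eta + 3 * S * e) * card U)%R].
Proof.
move=> th0 eta0 S0 psiS many cand_ok fiber shad.
pose s (p : G * nat) := p.2.
pose B (p : G * nat) := rtrans (F p.2) p.1.
pose C (p : G * nat) := rtrans (core R F b p.2) p.1.
pose r0 := [seq p <- [seq (h, n) | h <- W, n <- iota 0 n0] | cand p.2 p.1].
pose r := sort (fun p q => s q <= s p)%N r0.
have mem_r p : (p \in r) = [&& p.1 \in W, (p.2 < n0)%N & cand p.2 p.1].
  rewrite mem_sort mem_filter andbC andbA; congr andb; apply/allpairsP/andP.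
    by move=> [[h n] /= [hW + ->]] /=; rewrite mem_iota add0n.
  by case: p => h n /= [hW nn]; exists (h, n); rewrite mem_iota.
have r_sorted : pairwise (fun p q => s q <= s p)%N r.
  rewrite -sorted_pairwise; last by move=> p q t pq qt; exact: leq_trans qt pq.
  by apply: sort_sorted => p q; exact: leq_total.
have e4 := e_small; have ep := e_gt0.
have e21 : (e + 2 * e <= 1)%R by lra.
(* The loss [d = 2 * e] is the proportion of [F n] outside its core. *)
have [p|J [Jr JU Je Jpsi]] := @greedy_selection R _ _ B C s psi e (2 * e) eta S r
    (ltW e_gt0) e21 S0 psiS r_sorted.
  rewrite mem_r => /and3P[pW pn pc]; have [p0 psum] := cand_ok _ _ pW pc.
  rewrite card_rtrans; split=> //.
    apply/fsubsetP => u; rewrite !in_rtrans; exact/fsubsetP/core_sub.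
  have -> : B p `\` C p = rtrans (F p.2 `\` core R F b p.2) p.1.
    by apply/fsetP => u; rewrite !(in_fsetD, in_rtrans).
  by rewrite card_rtrans; exact: card_coreD.
have J_W p : p \in J -> [/\ p.1 \in W, (p.2 < n0)%N & cand p.2 p.1].
  by move=> /Jr; rewrite mem_r => /and3P.
set U := \bigcup_(p <- J) C p in JU Jpsi.
pose rho := (\sum_(p <- J) card (F p.2))%R.
have rhoE : (\sum_(p <- J) card (B p) = rho)%R.
  by apply: eq_bigr => p _; rewrite card_rtrans.
have card_C p : (card (C p) <= card (F p.2))%R.
  by rewrite card_rtrans le_card_fset ?core_sub.
rewrite rhoE in JU Jpsi.
have rho0 : (0 <= rho)%R by rewrite sumr_ge0.
have card_V (P : pred (G * nat)) : (card (\bigcup_(q <- J | P q) C q) <=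
    \sum_(q <- J | P q) card (F q.2))%R.
  apply: le_trans (card_bigfcup_le _ _ _ _) _.
  by apply: ler_sum => q _; exact: card_C.
pose near h := has (fun q => h \in rtrans (shadow R F b q.2) q.1) J.
have WE : (card W = card [fset h in W | near h] + card [fset h in W | ~~ near h])%R.
  by rewrite -!sum1_fset; exact: big_fsetID.
(* The shadow of a selected [F n h] absorbs at most [theta * (1 + e) * card (F n)] points of [W]. *)
have le_near : (card [fset h in W | near h] <= theta * (1 + e) * rho)%R.
  pose Z q := [fset h in W | h \in rtrans (shadow R F b q.2) q.1].
  apply: (@le_trans _ _ (card (\bigcup_(q <- J) Z q))).
    apply: le_card_fset; apply/fsubsetP => h; rewrite !inE /=.
    move=> /andP[hW /hasP[q qJ hq]]; apply/bigfcupP; exists q; rewrite ?qJ//.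
    by rewrite !inE hW.
  apply: le_trans (card_bigfcup_le _ _ _ _) _.
  rewrite mulr_sumr big_seq [leRHS]big_seq; apply: ler_sum => q qJ.
  have [qW _ qc] := J_W _ qJ.
  have ZW : Z q `<=` W by apply/fsubsetP => h; rewrite !inE => /andP[].
  have Zs h : h \in Z q -> h \in rtrans (shadow R F b q.2) q.1.
    by rewrite !inE => /andP[].
  apply: le_trans (shad _ _ (Z q) qW qc ZW Zs) _; rewrite -mulrA ler_wpM2l//.
  exact: (card_past_shadow F_neq0 tempL tempR b_F0 e_small Zs).
set E := [fset h in W | ~~ near h] in WE *.
(* Selected cores of scale at least [n] cover a proportion [e] of a candidate [F n h]; if [h] is in
   no selected shadow, [in_shadow] excludes the scales beyond [n.+1]. *)
pose V n := \bigcup_(q <- J | (q.2 == n) || (q.2 == n.+1)) C q.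
have E_V h n : h \in E -> (n < n0)%N -> cand n h ->
    (e * card (F n) <= card [fset u in V n | u \in rtrans (F n) h])%R.
  rewrite !inE => /andP[hW /= hn] nn0 hc.
  have := Je (h, n); rewrite mem_r /= hW nn0 hc /= card_rtrans => /(_ isT) /le_trans.
  apply; apply: le_card_fset; apply/fsubsetP => u.
  rewrite in_fsetI !inE /= => /andP[uB /bigfcupP[q /andP[qJ /= nq] uC]].
  rewrite /= uB andbT; apply/bigfcupP; exists q => //; rewrite qJ /=.
  have [//|] := boolP ((q.2 == n) || (q.2 == n.+1)) => nq'.
  have nq2 : (n < q.2.-1)%N by exact: ltn_pred_of_neq nq nq'.
  have /hasPn /(_ q qJ) /negP[] := hn.
  apply: (in_shadow (g := (u * h^-1)%g) nq2); first by rewrite -in_rtrans.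
  by rewrite mulgVK.
(* Double counting of the triples [(h, n, u)] with [u] both in [V n] and in the candidate [F n h].
   Each [u] serves few [h], by the bound on fibres, and each selected piece enters [V n] for at most
   two [n]: this is offset by the [2] in the lower bound on the number of candidates. *)
have le_E : (card E <= theta * (1 + e) * e * rho)%R.
  have lower : (2 * card E <= e * (\sum_(h <- E) \sum_(n < n0)
      ((cand n h)%:R * e)))%R.
    rewrite -sum1_fset !mulr_sumr big_seq [leRHS]big_seq; apply: ler_sum => h.
    rewrite !inE /= => /andP[hW _]; rewrite mulr1.
    by apply: le_trans (many h hW) _; rewrite -mulr_suml; lra.
  have upper : (\sum_(h <- E) \sum_(n < n0) ((cand n h)%:R * e) <=
      \sum_(n < n0) (theta * (1 + e) * card (V n)))%R.
    rewrite exchange_big /=; apply: ler_sum => n _.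
    have Fn := card_F_gt0 R F_neq0 n.
    rewrite -(ler_pM2r Fn) mulr_suml.
    apply: (@le_trans _ _ (\sum_(h <- E) \sum_(u <- V n)
        (cand n h && (u \in rtrans (F n) h))%:R)%R).
      rewrite big_seq [leRHS]big_seq; apply: ler_sum => h hE.
      have [hc|] := boolP (cand n h); last by rewrite !mul0r sumr_ge0.
      by rewrite mul1r -card_fset_sep; exact: E_V.
    rewrite exchange_big /=.
    apply: (@le_trans _ _ (\sum_(u <- V n) (1 * (theta * (1 + e) * card (F n)))))%R.
      apply: ler_sum => u _; rewrite -card_fset_sep mul1r -mulrA.
      set X := [fset h in E | _].
      have XW : X `<=` W.
        by apply/fsubsetP => h; rewrite !inE => /andP[/andP[]].
      have Xc h : h \in X -> cand n h by rewrite !inE /= => /andP[_ /andP[]].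
      have Xu h : h \in X -> u \in rtrans (F n) h.
        by rewrite !inE /= => /andP[_ /andP[]].
      apply: le_trans (fiber _ _ XW Xc) _; rewrite ler_wpM2l//.
      exact: (card_past_fiber tempR Xu).
    by rewrite -mulr_suml sum1_fset; lra.
  have V_rho : (\sum_(n < n0) card (V n) <= 2 * rho)%R.
    apply: (@le_trans _ _ (\sum_(n < n0) \sum_(q <- J)
        ((q.2 == n)%:R + (q.2 == n.+1)%:R) * card (F q.2)))%R.
      apply: ler_sum => n _; apply: le_trans (card_V _) _.
      rewrite big_mkcond; apply: ler_sum => q _.
      have c0 : (0 <= card (F q.2))%R by [].
      by case: eqP => _; case: eqP => _ //=; lra.
    rewrite exchange_big /= mulr_sumr; apply: ler_sum => q _.
    rewrite -mulr_suml ler_wpM2r// big_split /=.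
    have one (f : nat -> nat) : injective f ->
        (\sum_(n < n0) (q.2 == f n)%:R <= 1 :> R)%R.
      move=> fI; by rewrite -natr_sum -[leRHS]/(1%:R) ler_nat; exact: sum_eq_le1.
    by have := one id (@inj_id nat); have := one succn succn_inj; lra.
  have := mulr_ge0 th0 (ltW e_gt0); have : (0 <= theta * (1 + e))%R.
    by rewrite mulr_ge0//; lra.
  rewrite -mulr_sumr in upper => t0 _.
  have := ler_wpM2l t0 V_rho; have := ler_wpM2l (ltW e_gt0) upper.
  nra.
exists U; split.
- apply/bigfcupsP => q qJ _; have [qW qn _] := J_W _ qJ.
  apply/fsubsetP => u; rewrite in_rtrans => uc.
  rewrite -(mulgVK q.1 u) in_fset_mulg//; apply/in_past; exists q.2 => //.
  exact: (fsubsetP (core_sub R F b q.2)).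
- have t0 : (0 <= theta * (1 + e) ^+ 2)%R by rewrite mulr_ge0// sqr_ge0.
  have : (card W <= theta * (1 + e) ^+ 2 * rho)%R by rewrite WE; lra.
  have := ler_wpM2l t0 JU; nra.
- have a0 : (0 <= eta + 3 * S * e)%R.
    by rewrite addr_ge0// !mulr_ge0//; lra.
  have := ler_wpM2l a0 JU; have e3 : (0 <= 1 - 3 * e)%R by lra.
  have := ler_wpM2l e3 Jpsi; lra.
Qed.

End Covering.

(** * Crossings of a gap *)

Section Crossings.
Variable R : realFieldType.
Implicit Types (a : nat -> R) (al be : R) (i j k m n : nat).

Definition level al be a i m : bool := if odd i then a m <= al else be <= a m.

(* The witness exposed by unfolding is the largest index [m_k] of
   [m_1 < ... < m_k < n]; levels are numbered from the smallest index. *)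
Fixpoint crossings al be a k n : Prop :=
  if k is k'.+1 then
    exists m, [/\ (m < n)%N, level al be a k m & crossings al be a k' m]
  else True.

Lemma crossings_mono al be a k m n : (m <= n)%N ->
  crossings al be a k m -> crossings al be a k n.
Proof.
case: k => //= k mn [l [lm ? ?]]; exists l; split=> //; exact: leq_trans mn.
Qed.

Lemma crossings_gt0 al be a k n : crossings al be a k.+1 n -> (0 < n)%N.
Proof. by move=> [m [mn _ _]]; exact: leq_ltn_trans mn. Qed.

(** Levels are numbered from the smallest index, so dropping the largest indices changes no
    parity. *)
Lemma crossings_leq al be a k k' n : (k <= k')%N ->
  crossings al be a k' n -> crossings al be a k n.
Proof.
move=> /subnK <-; elim: (k' - k)%N => // d IH [m [mn _ cm]].
by apply: IH; exact: crossings_mono (ltnW mn) cm.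
Qed.

(* Taking the largest scale at each step, with slightly relaxed thresholds, makes
   the scales of a point [h] dominate those of every point at which the averages
   are close to those at [h] (see [crossings_last_scale]). The maximum is [0] if
   there is no admissible scale. *)
Fixpoint last_scale al be a K n j : nat :=
  if j is j'.+1 then
    \max_(m < last_scale al be a K n j' | level al be a (K - j') m) m
  else n.

Lemma last_scale_le al be a K n j j' : (j <= j')%N ->
  (last_scale al be a K n j' <= last_scale al be a K n j)%N.
Proof.
move=> /subnK <-; elim: (j' - j)%N => // d IH.
rewrite addSn; apply: leq_trans IH => /=.
by apply/bigmax_leqP => m _; exact: ltnW.
Qed.

(** Step by step, the indices of a crossing of [a'], taken downwards, are at most the greedy maxima
    of [a]: an index beyond the [J]-th maximum is admissible for [a] by the closeness hypothesis,
    and the others are below all maxima concerned. *)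
Lemma crossings_last_scale al be al' be' a a' K n J : (J <= K)%N ->
  (forall i m, (last_scale al' be' a K n J < m)%N -> level al be a' i m ->
     level al' be' a i m) ->
  crossings al be a' K n ->
  crossings al be a' (K - J) (last_scale al' be' a K n J).
Proof.
move=> JK near cK; suff: forall j, (j <= J)%N ->
    crossings al be a' (K - j) (last_scale al' be' a K n j) by apply.
elim=> [|j IH] jJ; first by rewrite subn0.
have := IH (ltnW jJ).
have -> : (K - j = (K - j.+1).+1)%N by rewrite subnSK// (leq_trans jJ).
move=> [m [mj lm cm]]; apply: crossings_mono cm.
have [mJ|Jm] := leqP m (last_scale al' be' a K n J).
  exact: leq_trans mJ (last_scale_le _ _ _ _ _ jJ).
have l' := near _ _ Jm lm; rewrite subnSK in l'; last exact: leq_trans JK.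
by rewrite /= -[m]/(nat_of_ord (Ordinal mj)) leq_bigmax_cond.
Qed.

Lemma level_weaken al be al' be' a i m : al <= al' -> be' <= be ->
  level al be a i m -> level al' be' a i m.
Proof.
by rewrite /level => h1 h2; case: odd => ?; [exact: le_trans h1|exact: le_trans h2 _].
Qed.

(** Comparing [a] with itself yields an admissible index at each step, so the maximum is attained
    and is not the default [0] of an empty one. *)
Lemma last_scaleP al be al' be' a K n j : al <= al' -> be' <= be ->
  (j < K)%N -> crossings al be a K n ->
  (last_scale al' be' a K n j.+1 < last_scale al' be' a K n j)%N /\
  level al' be' a (K - j) (last_scale al' be' a K n j.+1).
Proof.
move=> al_le be_le jK cK.
have := crossings_last_scale (ltnW jK)
  (fun i m _ => @level_weaken al be al' be' a i m al_le be_le) cK.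
have -> : (K - j = (K - j.+1).+1)%N by rewrite subnSK.
move=> [m [mj lm _]]; rewrite subnSK// in lm *.
have [|i li iE] := @eq_bigmax_cond _
    [pred i : 'I_(last_scale al' be' a K n j) | level al' be' a (K - j) i] val.
  apply/card_gt0P; exists (Ordinal mj); rewrite inE /=.
  exact: level_weaken lm.
have -> : last_scale al' be' a K n j.+1 = i by rewrite -[RHS]iE.
by split; [exact: ltn_ord | exact: li].
Qed.

Lemma last_scale_lt al be al' be' a K n j j' : al <= al' -> be' <= be ->
  (j < j')%N -> (j' <= K)%N -> crossings al be a K n ->
  (last_scale al' be' a K n j' < last_scale al' be' a K n j)%N.
Proof.
move=> al_le be_le jj' jK cK; apply: leq_ltn_trans (last_scale_le _ _ _ _ _ jj') _.
by have [] := last_scaleP al_le be_le (leq_trans jj' jK) cK.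
Qed.

End Crossings.

Lemma le_sum_mem_iota (s : seq nat) (n : nat) : uniq s -> {subset s <= iota 0 n} ->
  (size s <= \sum_(m < n) (nat_of_ord m \in s))%N.
Proof.
move=> us sn; rewrite -(big_mkord xpredT (fun m => nat_of_bool (m \in s))).
have -> : (\sum_(0 <= m < n) (m \in s))%N = size [seq m <- iota 0 n | m \in s].
  rewrite size_filter -sum1_count /index_iota subn0.
  rewrite [RHS]big_mkcond; apply: eq_bigr => m _; by case: (m \in s).
by apply: uniq_leq_size us _ => m ms; rewrite mem_filter ms sn.
Qed.

(** * Decay in the number of crossings *)

Lemma dist_sum_fset_le (R : realFieldType) (T : choiceType) (A B : {fset T})
    (f : T -> R) (S : R) : #|` A| = #|` B| -> (forall u, `|f u| <= S) ->
  `|\sum_(u <- A) f u - \sum_(u <- B) f u| <= 2 * S * #|` (A `\` B)%fset|%:R.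
Proof.
move=> AB fS.
have BA : #|` (B `\` A)%fset| = #|` (A `\` B)%fset|.
  by rewrite !cardfsD AB fsetIC.
rewrite (sum_fset_sub f (fsubsetIl A B)) (sum_fset_sub f (fsubsetIr A B)).
have -> : (A `\` (A `&` B) = A `\` B)%fset.
  by apply/fsetP => u; rewrite !inE; case: (u \in A); case: (u \in B).
have -> : (B `\` (A `&` B) = B `\` A)%fset.
  by apply/fsetP => u; rewrite !inE; case: (u \in A); case: (u \in B).
rewrite opprD addrACA subrr add0r.
apply: le_trans (ler_normB _ _) _.
have := norm_sum_fset_le (A `\` B)%fset fS.
by have := norm_sum_fset_le (B `\` A)%fset fS; rewrite BA; lra.
Qed.

Section Decay.
Variables (R : realType) (G : groupType) (F : nat -> {fset G}) (e : R).
Local Open Scope fset_scope.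
Local Notation card A := (#|` A|%:R : R)%R.
Hypothesis F_neq0 : forall n, F n != fset0.
Hypothesis tempL :
  forall n, (card (fset_mulg (fset_invg (past F n)) (F n)) <= (1 + e) * card (F n))%R.
Hypothesis tempR :
  forall n, (card (fset_mulg (F n) (fset_invg (past F n))) <= (1 + e) * card (F n))%R.
Variable b : G.
Hypothesis b_F0 : b \in F 0%N.
Hypothesis e_gt0 : (0 < e)%R.
Variables (phi : G -> R) (S alpha beta : R).
Hypothesis phi_le : forall u, (`|phi u| <= S)%R.

Local Notation avg h := (fun n => ergodic_avg F (fun g x => g * x)%g phi n h).

Lemma avgE n h : (avg h n * card (F n) = \sum_(u <- rtrans (F n) h) phi u)%R.
Proof.
by rewrite /ergodic_avg mulfVK ?gt_eqF ?card_F_gt0// sum_rtrans.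
Qed.

(** Here [h' = a * c * h] with [a^-1] and [c] in [past F n], so that by [right_shift] all but a
    proportion [e] of [F n a c] lies in [F n]. *)
Lemma avg_shift m n h h' : (m < n)%N ->
  h' \in rtrans (fset_mulg (fset_invg (past F m)) (F m)) h ->
  (`|avg h' n - avg h n| <= 2 * S * e)%R.
Proof.
move=> mn; rewrite in_rtrans => /fset_mulgP[a [c [+ cF hE]]].
rewrite in_fset_invg => ap.
have ap' : (a^-1)%g \in past F n by exact: (fsubsetP (past_sub _ (ltnW mn))) ap.
have cp : c \in past F n by apply/in_past; exists m.
have Fn := card_F_gt0 R F_neq0 n.
rewrite -(ler_pM2r Fn) -[X in (_ * X)%R](gtr0_norm Fn) -normrM mulrBl !avgE.
have -> : h' = (a * c * h)%g by rewrite -hE mulgVK.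
have -> : rtrans (F n) (a * c * h)%g = rtrans (rtrans (F n) (a * c)%g) h.
  by apply/fsetP => u; rewrite !in_rtrans invgM mulgA.
have S0 : (0 <= S)%R := le_trans (normr_ge0 _) (phi_le 1%g).
rewrite !(sum_rtrans _ h).
apply: le_trans (dist_sum_fset_le _ (S := S) _) _; rewrite ?card_rtrans//.
rewrite -[leRHS]mulrA ler_wpM2l ?mulr_ge0//.
apply: le_trans (right_shift tempR ap' cp).
apply: (@le_card_inj R _ _ (fun u => u * (a * c)^-1)%g) => [|u]; first exact: mulIg.
rewrite in_fsetD in_rtrans !inE /= => /andP[uF ->] /=.
by rewrite invgK -mulgA mulgVK.
Qed.

(** Since [W] is arbitrary, the bound can be used on the fibres and shadows of the covering
    argument. *)
Definition decays k (theta : R) := forall n (W : {fset G}), (0 < n)%N ->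
  (forall h, h \in W -> crossings alpha beta (avg h) k n) ->
  (card W <= theta * card (fset_mulg (past F n) W))%R.

Lemma decays0 : decays 0 1.
Proof.
move=> n W n0 _; rewrite mul1r.
apply: (@le_card_inj R _ _ (fun x => b * x)%g) => [|x xW]; first exact: mulgI.
by rewrite in_fset_mulg// (b_past b_F0).
Qed.

Hypothesis e_small : (4 * e < 1)%R.
Variables (k r : nat) (theta : R).
Hypothesis theta_ge0 : (0 <= theta)%R.
Hypothesis r_large : (2 <= e ^+ 2 * r%:R)%R.
Hypothesis decays_k : decays k theta.

Local Notation K := (k + 2 * r).+1.
Local Notation al' := (alpha + 2 * S * e)%R.
Local Notation be' := (beta - 2 * S * e)%R.

(** With [par] true the low levels are used, with [par] false the high ones. The candidates of a
    point are the [r] scales of that parity among its [2 * r] largest; at least [k.+1] crossings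
    remain below each of them, so [decays_k] bounds the fibres and shadows. *)
Lemma level_covering (n0 : nat) (W : {fset G}) (par : bool) (psi : G -> R) (S' : R) :
  (0 < n0)%N ->
  (forall h, h \in W -> crossings alpha beta (avg h) K n0) ->
  (forall u, `|psi u| <= S')%R ->
  (forall i n h, odd i = par -> level al' be' (avg h) i n ->
     \sum_(u <- rtrans (F n) h) psi u <= 2 * S * e * card (F n))%R ->
  exists U : {fset G}, [/\ U `<=` fset_mulg (past F n0) W,
    ((1 - 3 * e) * card W <= theta * (1 + e) ^+ 2 * card U)%R &
    ((1 - 3 * e) * (\sum_(u <- U) psi u) <= (2 * S * e + 3 * S' * e) * card U)%R].
Proof.
move=> n00 WK psiS psi_level.
have S0 : (0 <= S)%R := le_trans (normr_ge0 _) (phi_le 1%g).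
have S'0 : (0 <= S')%R := le_trans (normr_ge0 _) (psiS 1%g).
have Se0 : (0 <= 2 * S * e)%R by rewrite !mulr_ge0// ltW.
have al_le : (alpha <= al')%R by rewrite lerDl.
have be_le : (be' <= beta)%R by rewrite gerBl.
(* The scale [tau h J] has level [K - J.-1], so this offset gives the levels [K - (2 * i + sh)] the
   parity [par]. *)
pose sh : nat := odd K (+) par.
pose tau h := last_scale al' be' (avg h) K n0.
pose sc h := [seq tau h (2 * i + sh).+1 | i <- iota 0 r].
pose cand n h := n \in sc h.
have shlt i : (i < r)%N -> ((2 * i + sh).+1 <= 2 * r)%N.
  by rewrite /sh; move: (_ (+) _) => c ir; clear -ir; case: c; lia.
have shK i : (i < r)%N -> ((2 * i + sh).+1 <= K)%N.
  by move=> /shlt h; clear -h; lia.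
have sc_uniq h : h \in W -> uniq (sc h).
  move=> hW; rewrite map_inj_in_uniq ?iota_uniq// => i j.
  rewrite !mem_iota !add0n => /andP[_ ir] /andP[_ jr] tij; apply/eqP; rewrite eqn_leq.
  apply/andP; split; rewrite leqNgt; apply/negP => lt.
    have lt' : ((2 * j + sh).+1 < (2 * i + sh).+1)%N by rewrite ltnS ltn_add2r ltn_mul2l.
    have := last_scale_lt al_le be_le lt' (shK _ ir) (WK h hW).
    by rewrite -/(tau h) tij ltnn.
  have lt' : ((2 * i + sh).+1 < (2 * j + sh).+1)%N by rewrite ltnS ltn_add2r ltn_mul2l.
  have := last_scale_lt al_le be_le lt' (shK _ jr) (WK h hW).
  by rewrite -/(tau h) tij ltnn.
  have sc_lt h : h \in W -> {subset sc h <= iota 0 n0}.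
  move=> hW _ /mapP[i + ->]; rewrite !mem_iota !add0n => /andP[_ ir].
  exact: (@last_scale_lt _ _ _ _ _ _ _ n0 0 (2 * i + sh).+1 al_le be_le isT (shK _ ir) (WK h hW)).
have candP n h : cand n h -> exists J, [/\ n = tau h J, (0 < J)%N, (J <= 2 * r)%N &
    odd (K - J.-1) = par].
  move=> /mapP[i + ->]; rewrite mem_iota add0n => /andP[_ ir].
  exists (2 * i + sh).+1; split => //; first exact: shlt.
  have iK := shK _ ir; rewrite /= oddB; last exact: ltnW.
  by rewrite oddD oddM /= oddb addbA addbb.
have self h J : h \in W -> (J <= K)%N ->
    crossings alpha beta (avg h) (K - J) (tau h J).
  move=> hW JK; apply: crossings_last_scale (WK h hW) => // i m _.
  exact: level_weaken.
apply: (@covering R G F e F_neq0 tempL tempR b b_F0 e_gt0 e_small W n0 cand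
  theta (2 * S * e)%R S' psi) => //.
- move=> h hW; apply: le_trans r_large _; rewrite ler_wpM2l ?sqr_ge0//.
  rewrite -natr_sum ler_nat -[leqLHS](size_iota 0 r) -(size_map (fun i => tau h (2 * i + sh).+1)).
  by apply: le_sum_mem_iota; [exact: sc_uniq|exact: sc_lt].
- move=> h n hW /candP[J [-> J0 J2 Jpar]]; split.
    have JK : (J < K)%N by clear -J2; lia.
    by have := self h J hW (ltnW JK); rewrite -(subnSK JK) => /crossings_gt0.
  apply: psi_level Jpar _.
  have [] := @last_scaleP _ _ _ _ _ _ _ n0 J.-1 al_le be_le _ (WK h hW); first by clear -J2; lia.
  by rewrite prednK.
- move=> n W' /fsubsetP W'W W'c.
  have [->|[x xW']] := fset_0Vmem W'.
    by rewrite cardfs0 mulr_ge0.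
  have cr h : h \in W' -> crossings alpha beta (avg h) k.+1 n.
    move=> hW'; have [J [-> J0 J2 _]] := candP _ _ (W'c _ hW').
    by apply: crossings_leq (self h J (W'W _ hW') _); clear -J2; lia.
  apply: decays_k; first exact: crossings_gt0 (cr x xW').
  by move=> h /cr; exact: crossings_leq.
- move=> h n W' hW /candP[J [-> J0 J2 _]] /fsubsetP W'W W's.
  have [->|[x xW']] := fset_0Vmem W'.
    by rewrite cardfs0 mulr_ge0.
  apply: decays_k.
    have := W's _ xW'; rewrite in_rtrans => /fset_mulgP[a [c [+ _ _]]].
    by rewrite in_fset_invg => /in_past[i im _]; exact: leq_ltn_trans im.
  move=> y yW'.
  (* Beyond the scale [tau h J] the averages at [y] and [h] differ by at most [2 * S * e], the
     margin between [alpha], [beta] and the relaxed thresholds, so the crossings at [y] compare with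
     the scales of [h]. *)
  have : crossings alpha beta (avg y) k.+1 (tau h J).
    apply: (@crossings_leq _ _ _ _ _ (K - J)); first by clear -J2; lia.
    apply: (@crossings_last_scale _ alpha beta); [by clear -J2; lia| |exact: WK (W'W _ yW')].
    move=> i m Jm.
    have : y \in rtrans (fset_mulg (fset_invg (past F (tau h J))) (F (tau h J))) h.
      by have := W's _ yW'; rewrite !in_rtrans; exact: (fsubsetP (shadow_sub _ _ _ _)).
    move=> /(avg_shift Jm); rewrite ler_norml => /andP[h1 h2].
    by rewrite /level; case: odd => ?; lra.
  (* The extra crossing in [K] is spent on passing from the scale to its predecessor. *)
  move=> [m [mJ _ cm]]; apply: crossings_mono cm; by rewrite -ltnS prednK// (leq_ltn_trans _ mJ).
Qed.

(** The covering is applied to [phi - alpha] at low levels and to [beta - phi] at high ones. If one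
    of the unions is at most [1 - 16 * e] of [V], the claim follows from [(1 + e)^2 (1 - 16 e) <= (1
    - 3 e) (1 - e)]. Otherwise both functions have a small sum over [V], although they add up to the
    constant [beta - alpha]. *)
Lemma decay_step : (84 * (S + `|alpha| + `|beta|) * e < beta - alpha)%R ->
  (16 * e <= 1)%R -> decays K ((1 - e) * theta).
Proof.
move=> gap e16 n0 W n00 WK.
have e0 := e_gt0.
set S' := (S + `|alpha| + `|beta|)%R in gap.
have S0 : (0 <= S)%R := le_trans (normr_ge0 _) (phi_le 1%g).
have a0 := normr_ge0 alpha; have b0 := normr_ge0 beta.
have psi1 u : (`|phi u - alpha| <= S')%R.
  apply: le_trans (ler_normB _ _) _; have := phi_le u; rewrite /S'; lra.
have psi2 u : (`|beta - phi u| <= S')%R.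
  apply: le_trans (ler_normB _ _) _; have := phi_le u; rewrite /S'; lra.
have sum1 h n (f : G -> R) c : (\sum_(u <- rtrans (F n) h) (f u - c) =
    \sum_(u <- rtrans (F n) h) f u - c * card (F n))%R.
  rewrite sumrB -(card_rtrans (F n) h) -sum1_fset mulr_sumr; congr (_ - _)%R.
  by apply: eq_bigr => u _; rewrite mulr1.
have [|U1 [U1V U1W U1s]] := @level_covering n0 W true (fun u => phi u - alpha)%R S' n00 WK psi1.
  move=> i n h oi; rewrite /level oi => le; rewrite sum1 -avgE -mulrBl.
  by rewrite ler_wpM2r//; lra.
have [|U2 [U2V U2W U2s]] := @level_covering n0 W false (fun u => beta - phi u)%R S' n00 WK psi2.
  move=> i n h oi; rewrite /level oi => le.
  have -> : (\sum_(u <- rtrans (F n) h) (beta - phi u) =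
     - \sum_(u <- rtrans (F n) h) (phi u - beta))%R.
    by rewrite -sumrN; apply: eq_bigr => u _; rewrite opprB.
  rewrite sum1 -avgE -mulrBl -mulNr ler_wpM2r//; lra.
set V := fset_mulg (past F n0) W in U1V U2V *.
have small (U : {fset G}) :
    ((1 - 3 * e) * card W <= theta * (1 + e) ^+ 2 * card U)%R ->
    (card U <= (1 - 16 * e) * card V)%R -> (card W <= (1 - e) * theta * card V)%R.
  move=> UW UV; have e3 : (0 < 1 - 3 * e)%R by lra.
  rewrite -(ler_pM2l e3); apply: le_trans UW _.
  have t0 : (0 <= theta * (1 + e) ^+ 2)%R by rewrite mulr_ge0// sqr_ge0.
  apply: le_trans (ler_wpM2l t0 UV) _.
  rewrite [leLHS](_ : _ = theta * card V * ((1 + e) ^+ 2 * (1 - 16 * e)))%R; last by ring.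
  rewrite [leRHS](_ : _ = theta * card V * ((1 - 3 * e) * (1 - e)))%R; last by ring.
  rewrite ler_wpM2l ?mulr_ge0//; have := exprn_ge0 2 (ltW e0); have := exprn_ge0 3 (ltW e0); lra.
have [/small|U1l] := leP (card U1) ((1 - 16 * e) * card V)%R; first exact.
have [/small|U2l] := leP (card U2) ((1 - 16 * e) * card V)%R; first exact.
have [V0|V_gt0] := leP (card V) 0%R.
  have := le_card_fset R U1V; have : card V = 0%R by apply/eqP; rewrite eq_le V0 /=.
  by move=> V00; rewrite V00 mulr0 in U1l *; lra.
(* [21 = 5 + 16]: the union [U] contributes at most [5 * S' * e * card V], and its complement in [V]
   at most [16 * S' * e * card V]. *)
have bound (U : {fset G}) psi : U `<=` V -> ((1 - 16 * e) * card V < card U)%R ->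
   (forall u, `|psi u| <= S')%R ->
   ((1 - 3 * e) * (\sum_(u <- U) psi u) <= (2 * S * e + 3 * S' * e) * card U)%R ->
   ((1 - 3 * e) * (\sum_(u <- V) psi u) <= 21 * S' * e * card V)%R.
  move=> UV Ul psiS Us; rewrite (sum_fset_sub psi UV) mulrDr.
  have := norm_sum_fset_le (V `\` U) psiS; rewrite ler_norml => /andP[_ VU].
  have VUc : (card (V `\` U) <= 16 * e * card V)%R.
    rewrite cardfsDS// natrB ?fsubset_leq_card//; lra.
  have S'0 : (0 <= S')%R := le_trans (normr_ge0 _) (psi1 1%g).
  have SS' : (S <= S')%R by rewrite /S'; lra.
  have h1 : (\sum_(u <- V `\` U) psi u <= S' * (16 * e * card V))%R.
    exact: le_trans VU (ler_wpM2l _ VUc).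
  have h0 : (0 <= S' * (16 * e * card V))%R by rewrite !mulr_ge0// ltW.
  have h2 : ((1 - 3 * e) * (\sum_(u <- V `\` U) psi u) <= S' * (16 * e * card V))%R.
    have e3 : (0 <= 1 - 3 * e)%R by lra.
    apply: le_trans (ler_wpM2l e3 h1) _; rewrite ler_piMl//; lra.
  have h3 : ((2 * S * e + 3 * S' * e) * card U <= 5 * S' * e * card V)%R.
    have Se : (S * e <= S' * e)%R by rewrite ler_wpM2r// ltW.
    have S'e : (0 <= S' * e)%R by rewrite mulr_ge0// ltW.
    have Se0 : (0 <= S * e)%R by rewrite mulr_ge0// ltW.
    apply: ler_pM => //; [lra|lra|exact: le_card_fset].
  lra.
have := bound _ _ U1V U1l psi1 U1s; have := bound _ _ U2V U2l psi2 U2s.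
have : (\sum_(u <- V) (phi u - alpha) + \sum_(u <- V) (beta - phi u) =
    (beta - alpha) * card V)%R.
  rewrite -big_split -sum1_fset mulr_sumr; apply: eq_bigr => u _ /=; ring.
set s1 := (\sum_(u <- V) _)%R; set s2 := (\sum_(u <- V) _)%R => s12 le2 le1.
exfalso.
have : ((1 - 3 * e) * ((beta - alpha) * card V) <= 42 * S' * e * card V)%R.
  by rewrite -s12; lra.
rewrite mulrA ler_pM2r// => le3.
have S'0 : (0 <= S')%R := le_trans (normr_ge0 _) (psi1 1%g).
have S'e : (0 <= S' * e)%R by rewrite mulr_ge0// ltW.
(* The two bounds add up to [42], and dividing by [1 - 3 * e >= 1 / 2] at most doubles this; hence
   the [84] of the gap hypothesis. *)
have : (2 * (1 - 3 * e) * (42 * S' * e) < (1 - 3 * e) * (beta - alpha))%R.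
  rewrite [ltLHS](_ : _ = (1 - 3 * e) * (84 * S' * e))%R; last by ring.
  rewrite ltr_pM2l//; lra.
have : (1 * (42 * S' * e) <= 2 * (1 - 3 * e) * (42 * S' * e))%R.
  by apply: ler_wpM2r; lra.
lra.
Qed.

End Decay.

(** * Transference to measure preserving systems *)

Section Fluctuations.
Variables (R : realType) (a : nat -> R) (al be : R).

Lemma crossings_ge k n : crossings al be a k n -> (k <= n)%N.
Proof.
elim: k n => // k IH n [m [mn _ /IH km]]; exact: leq_ltn_trans mn.
Qed.

Lemma fluctuatesP N :
  fluctuates a al be N <-> exists M, crossings al be a (2 * N) M.
Proof.
split=> [[n [n_incr n_level]]|[M]].
  suff cr k : (k <= 2 * N)%N -> crossings al be a k (n k).+1.
    by exists (n (2 * N)%N).+1; exact: cr.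
  elim: k => // k IH kN; exists (n k.+1); split => //; first exact: n_level.
  case: k => // k in IH kN *; apply: crossings_mono (IH (ltnW kN)).
  exact: n_incr.
set K := (2 * N)%N.
suff: forall k M, crossings al be a k M -> exists n : nat -> nat,
   [/\ forall i j, (0 < i)%N -> (i < j)%N -> (j <= k)%N -> (n i < n j)%N,
     forall i, (0 < i <= k)%N -> level al be a i (n i) &
     forall i, (0 < i <= k)%N -> (n i < M)%N].
  by move=> h /h[n [? ? _]]; exists n.
elim=> [M' _|k IH M' [m [mM lm /IH[n [n_incr n_level n_lt]]]]].
  by exists id; split => [i [|j]|[|i]|[|i]].
exists (fun i => if i == k.+1 then m else n i); split.
- move=> i j i0 ij jk; rewrite ltn_eqF ?(leq_trans ij)//.
  case: eqP => [jE|/eqP jE]; last by apply: n_incr => //; rewrite -ltnS ltn_neqAle jE.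
  by apply: n_lt; rewrite i0 -ltnS -jE.
- move=> i /andP[i0 ik]; case: eqP => [-> //|/eqP iE].
  by apply: n_level; rewrite i0 -ltnS ltn_neqAle iE.
- move=> i /andP[i0 ik]; case: eqP => [//|/eqP iE].
  by apply: ltn_trans mM; apply: n_lt; rewrite i0 -ltnS ltn_neqAle iE.
Qed.

(** An index with [k + 2 * n0] crossings below it is at least [n0], so the top [k] crossings lie in
    the tail; as an even number of levels is dropped, parities are kept. *)
Lemma crossings_tail n0 k n : crossings al be a (k + 2 * n0) n ->
  crossings al be (fun i => a (n0 + i)%N) k (n - n0).
Proof.
elim: k n => // k IH n; rewrite addSn => -[m [mn lm cm]].
have n0m : (n0 <= m)%N by have := crossings_ge cm; lia.
exists (m - n0)%N; split; [lia| |exact: IH].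
by move: lm; rewrite /level -addSn oddD oddM /= addbF subnKC.
Qed.

End Fluctuations.

Section Measure.
Variables (R : realType) (G : groupType) (F : nat -> {fset G}).
Variables (d : measure_display) (X : measurableType d) (mu : probability X R).
Variables (T : G -> X -> X) (al be : R).
Hypothesis muT : mp_system mu T.

Local Notation crossing_set f k n :=
  [set x | crossings al be (fun m => ergodic_avg F T f m x) k n].

Lemma measurable_ergodic_avg (f : X -> R) n : measurable_fun [set: X] f ->
  measurable_fun [set: X] (ergodic_avg F T f n).
Proof.
move=> mf; apply: measurable_funM => //.
apply: measurable_sum => g; apply: measurableT_comp => //.
exact: mp_measurable muT g.
Qed.

Lemma measurable_crossing_set (f : X -> R) k n : measurable_fun [set: X] f ->
  measurable (crossing_set f k n).
Proof.
move=> mf; elim: k n => [n|k IH n] /=.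
  by rewrite (_ : [set _ | _] = setT)//; apply/seteqP; split.
rewrite (_ : [set _ | _] = \bigcup_(m in `I_n)
   ([set x | level al be (fun m => ergodic_avg F T f m x) k.+1 m] `&`
    crossing_set f k m)); last first.
  apply/seteqP; split => x /=.
    by move=> [m [mn lm cm]]; exists m.
  by move=> [m /= mn [lm cm]]; exists m.
apply: bigcup_measurable => m _; apply: measurableI => //.
have mavg := measurable_ergodic_avg m mf.
have msub (A : set R) : measurable A -> measurable (ergodic_avg F T f m @^-1` A).
  by move=> mA; rewrite -[X in measurable X]setTI; exact: mavg.
rewrite /level; case: (odd k.+1).
  rewrite (_ : [set x | _] = ergodic_avg F T f m @^-1` `]-oo, al]); first exact: msub.
  by apply/seteqP; split => x /=; rewrite in_itv.
rewrite (_ : [set x | _] = ergodic_avg F T f m @^-1` `[be, +oo[); first exact: msub.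
by apply/seteqP; split => x /=; rewrite in_itv /= andbT.
Qed.

Lemma measurable_fluctuation_set (f : X -> R) N : measurable_fun [set: X] f ->
  measurable (fluctuation_set F T f al be N).
Proof.
move=> mf; rewrite (_ : fluctuation_set _ _ _ _ _ _ =
    \bigcup_M crossing_set f (2 * N) M); last first.
  apply/seteqP; split => x /=.
    by move=> /fluctuatesP[M cM]; exists M.
  by move=> [M _ cM]; apply/fluctuatesP; exists M.
by apply: bigcup_measurable => M _; exact: measurable_crossing_set.
Qed.

Variables (e S : R).
Hypothesis F_neq0 : forall n, F n != fset0.
Hypothesis tempR : forall n, #|` fset_mulg (F n) (fset_invg (past F n))|%:R
  <= (1 + e) * #|` F n|%:R.

(** For each [x], decay for [g |-> f (T g x)] bounds the number of [h] in [(F n)^-1] with [T h x] in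
    the set; integrating over [x] and using invariance of [mu] gives the measure. *)
Lemma mu_crossing_set (f : X -> R) k n theta : 0 <= theta -> (0 < n)%N ->
  measurable_fun [set: X] f -> (forall x, `|f x| <= S) ->
  (forall phi : G -> R, (forall g, `|phi g| <= S) -> decays F phi al be k theta) ->
  (mu (crossing_set f k n) <= (theta * (1 + e))%:E)%E.
Proof.
move=> theta0 n0 mf fS dec; set D := crossing_set f k n.
have mD : measurable D by exact: measurable_crossing_set.
pose K := fset_invg (F n).
have count x : \sum_(h <- K) \1_D (T h x) <= theta * (1 + e) * #|` F n|%:R :> R.
  have dx := dec (fun g => f (T g x)) (fun g => fS _).
  pose W := [fset h in K | `[< D (T h x) >]]%fset.
  have -> : \sum_(h <- K) \1_D (T h x) = #|` W|%:R :> R.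
    rewrite card_fset_sep; apply: eq_bigr => h _; rewrite indicE.
    by congr (nat_of_bool _)%:R; apply/idP/asboolP; rewrite inE.
  apply: le_trans (dx n W n0 _) _.
    move=> h; rewrite !inE /= => /andP[_ /asboolP]; rewrite /D /=.
    set a1 := (fun m => _); set a2 := (fun m => _).
    rewrite (_ : a1 = a2)//; apply/funext => m; rewrite /a1 /a2 /ergodic_avg.
    by congr (_ / _); apply: eq_bigr => g _; rewrite (mp_actionM muT).
  (* As [W] lies in [(F n)^-1], every [F n h] with [h] in [W] contains [1]. *)
  rewrite -mulrA ler_wpM2l//; apply: (card_past_fiber tempR (u := 1%g)).
  by move=> h; rewrite !inE /= in_rtrans mul1g => /andP[+ _]; rewrite in_fset_invg.
have muTD h : mu (T h @^-1` D) = mu D by exact: mp_preserving muT h D mD.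
have mTD h : measurable (T h @^-1` D).
  by rewrite -[X in measurable X]setTI; exact: (mp_measurable muT).
have Fn : (0 < #|` F n|%:R :> R) by rewrite ltr0n cardfs_gt0.
have intE : (\int[mu]_x (\sum_(h <- K) (\1_(T h @^-1` D) x)%:E) =
    #|` F n|%:R%:E * mu D)%E.
  rewrite ge0_integral_sum//=; last first.
    by move=> h; apply/measurable_EFinP; exact: measurable_indic.
  rewrite (eq_bigr (fun=> mu D)); last first.
    by move=> h _; rewrite integral_indic// setIT; exact: muTD.
  rewrite big_const_seq count_predT -(card_fset_invg (F n)) -/K.
  have -> : size K = #|` K| by [].
  elim: (#|` K|) => [|m IH] /=; first by rewrite mul0e.
  by rewrite IH -[m.+1]add1n natrD EFinD ge0_muleDl ?lee_fin// mul1e.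
have : (#|` F n|%:R%:E * mu D <= \int[mu]_x (cst (theta * (1 + e) * #|` F n|%:R)%:E x))%E.
  rewrite -intE; apply: ge0_le_integral => //.
  - by move=> x _; apply: sume_ge0 => h _; rewrite lee_fin.
  - apply: emeasurable_sum => h; apply/measurable_EFinP; exact: measurable_indic.
  - by move=> x _; rewrite sumEFin lee_fin; exact: count.
rewrite integral_cst// => le_mu.
have {}le_mu : (#|` F n|%:R%:E * mu D <= (theta * (1 + e) * #|` F n|%:R)%:E)%E.
  by rewrite -[leRHS]mule1 -(probability_setT mu).
move: le_mu; rewrite -(@fineK _ (mu D)) ?fin_num_measure//.
by rewrite -EFinM !lee_fin mulrC ler_pM2r.
Qed.

End Measure.

(** Truncating [f] to [[-S, S]] changes it on a null set only, and the averages involve countably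
    many transformations, each of which pulls null sets back to null sets. *)
Lemma mu_fluctuation_set_clamp (R : realType) (G : groupType) (F : nat -> {fset G})
    (d : measure_display) (X : measurableType d) (mu : probability X R)
    (T : G -> X -> X) (al be S : R) (f : X -> R) :
  mp_system mu T -> 0 <= S -> measurable_fun [set: X] f ->
  ('N[mu]_+oo%E[EFin \o f] <= S%:E)%E ->
  exists g : X -> R, [/\ measurable_fun [set: X] g, forall x, `|g x| <= S &
    forall N, (mu (fluctuation_set F T f al be N) <=
               mu (fluctuation_set F T g al be N))%E].
Proof.
move=> muT S0 mf; rewrite unlock /Lnorm.
have -> : (0 < mu [set: X])%E by rewrite probability_setT lte01.
move=> /ess_supP [Z [mZ Z0 fZ]].
pose g : X -> R := (cst S \min (cst (- S) \max f)).
have mg : measurable_fun [set: X] g.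
  apply: measurable_minr => //; exact: measurable_maxr.
have gS x : `|g x| <= S.
  by rewrite ler_norml /g /= le_min ge_min le_max lexx /= lexx andbT; lra.
have gf x : ~ Z x -> g x = f x.
  move=> nZ; have : `|f x| <= S.
    rewrite leNgt; apply/negP => lt; apply: nZ; apply: fZ => /=.
    by apply/negP; rewrite -ltNge lte_fin.
  by rewrite ler_norml /g /= => /andP[/max_r -> /min_r].
exists g; split => // N.
(* Elements of [F n] are listed by position, to have a countable union; positions beyond the size
   give the default [1], whose preimage of [Z] is null too. *)
have [Y [mY Y0 YZ]] : mu.-negligible
    (\bigcup_n \bigcup_i (T (nth 1%g (F n) i) @^-1` Z)).
  apply: negligible_bigcup => n; apply: negligible_bigcup => i.
  exists (T (nth 1%g (F n) i) @^-1` Z); split => //.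
    by rewrite -[X in measurable X]setTI; exact: (mp_measurable muT).
  by rewrite -[RHS]Z0; exact: mp_preserving muT _ _ mZ.
have sub : fluctuation_set F T f al be N `<=` fluctuation_set F T g al be N `|` Y.
  move=> x fx; have [|nY] := pselect (Y x); [by right|left].
  move: fx; rewrite /fluctuation_set /=.
  set a1 := (fun n => _); set a2 := (fun n => _).
  rewrite (_ : a1 = a2)//; apply/funext => n; rewrite /a1 /a2 /ergodic_avg.
  congr (_ / _); apply: eq_fbigr => h hF _; rewrite gf// => Zh.
  apply: nY; apply: YZ; exists n => //; exists (index h (F n)) => //.
  by rewrite /= nth_index.
have mfl (h : X -> R) : measurable_fun [set: X] h ->
    measurable (fluctuation_set F T h al be N).
  by move=> mh; exact (measurable_fluctuation_set F _ _ muT _ mh).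
apply: le_trans (le_measure mu _ _ sub) _; rewrite ?inE; [exact: mfl| |].
  by apply: measurableU => //; exact: mfl.
apply: (@le_trans _ _ (mu (fluctuation_set F T g al be N) + mu Y)%E).
  exact: measureU2 mu _ _ (mfl _ mg) mY.
have {}Y0 : mu Y = 0%E := Y0.
by rewrite Y0 adde0.
Qed.

(** * Exponential rate and choice of the constants *)

Lemma bernoulli_ge (R : realDomainType) (x : R) (m : nat) :
  0 <= x <= 1 -> 1 - m%:R * x <= (1 - x) ^+ m.
Proof.
move=> /andP[x0 x1]; elim: m => [|m IH]; first by rewrite mul0r subr0 expr0.
rewrite exprS; apply: le_trans (ler_wpM2l _ IH); last by lra.
rewrite -natr1; have : 0 <= m%:R * x ^+ 2 by rewrite mulr_ge0// exprn_ge0.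
lra.
Qed.

Lemma leq_sub_mul_div (k m : nat) : (0 < m)%N -> (k - m <= m * (k %/ m))%N.
Proof.
move=> m0; rewrite leq_subLR {1}(divn_eq k m) addnC mulnC leq_add2r.
by rewrite ltnW// ltn_mod.
Qed.

Section Exponential.
Variables (R : realType) (G : groupType) (F : nat -> {fset G}) (al be S : R).
Local Open Scope fset_scope.
Local Notation card A := (#|` A|%:R : R)%R.
Hypothesis F_neq0 : forall n, F n != fset0.
Let S' := (S + `|al| + `|be|)%R.
Let e := ((be - al) / (128 * S'))%R.
Hypothesis S_gt0 : (0 < S)%R.
Hypothesis al_be : (al < be)%R.
Hypothesis tempL :
  forall n, (card (fset_mulg (fset_invg (past F n)) (F n)) <= (1 + e) * card (F n))%R.
Hypothesis tempR :
  forall n, (card (fset_mulg (F n) (fset_invg (past F n))) <= (1 + e) * card (F n))%R.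

(** By choice of [e], [128 * S' * e = be - al], and [be - al <= |al| + |be| <= S']; the last bound
    also gives the smallness of [e] required by [decay_step]. *)
Lemma decay_rate_bounds : [/\ 0 < e, 84 * S' * e < be - al & 128 * e <= 1]%R.
Proof.
have a0 := normr_ge0 al; have b0 := normr_ge0 be.
have S0 := S_gt0; have ab := al_be.
have S'0 : (0 < S')%R by rewrite /S'; lra.
have eE : (128 * S' * e = be - al)%R.
  by rewrite /e mulrC divfK// gt_eqF// mulr_gt0.
have e0 : (0 < e)%R by rewrite /e divr_gt0 ?mulr_gt0// subr_gt0.
have Se : (0 < S' * e)%R by rewrite mulr_gt0.
split => //; first by lra.
rewrite -(ler_pM2r S'0) mul1r mulrAC eE /S'.
by have := ler_norm be; have := ler_norm (- al); rewrite normrN; lra.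
Qed.

Lemma decays_iter r j (phi : G -> R) : (2 <= e ^+ 2 * r%:R)%R ->
  (forall g, `|phi g| <= S)%R ->
  decays F phi al be (j * (2 * r).+1) ((1 - e) ^+ j).
Proof.
move=> er phiS; have [e0 e84 e128] := decay_rate_bounds.
have /fset0Pn[b bF] := F_neq0 0.
have e4 : (4 * e < 1)%R by lra.
have e16 : (16 * e <= 1)%R by lra.
elim: j => [|j IH]; first by rewrite mul0n expr0; exact: decays0 bF _ _ _.
have -> : (j.+1 * (2 * r).+1 = (j * (2 * r).+1 + 2 * r).+1)%N by rewrite mulSn addnC addnS.
rewrite exprS; apply: (decay_step F_neq0 tempL tempR bF) => //.
by rewrite exprn_ge0//; lra.
Qed.

(** Each block of [m = 2 * r + 1] crossings gains a factor [1 - e]. With [c = 1 - e / m],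
    Bernoulli's inequality gives [1 - e <= c ^+ m] without taking roots; the incomplete block costs
    the shift [k - m], and [2] bounds the factor [1 + e] of the transference. *)
Lemma mu_crossings_le : exists c : R, [/\ 0 < c, c < 1 & exists2 m : nat, (0 < m)%N &
  forall (d : measure_display) (X : measurableType d) (mu : probability X R)
      (T : G -> X -> X) (f : X -> R),
    mp_system mu T -> measurable_fun [set: X] f -> (forall x, `|f x| <= S) ->
    forall k n, (0 < n)%N ->
    (mu [set x | crossings al be (fun i => ergodic_avg F T f i x) k n]
      <= (2 * c ^+ (k - m))%:E)%E]%R.
Proof.
have [e0 e84 e128] := decay_rate_bounds.
have e20 : (0 < e ^+ 2)%R by rewrite exprn_gt0.
pose r := Num.bound (2 / e ^+ 2).
have er : (2 <= e ^+ 2 * r%:R)%R.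
  have := archi_boundP (divr_ge0 (ler0n R 2) (ltW e20)).
  by rewrite -/r ltr_pdivrMr// mulrC => /ltW.
pose m := (2 * r).+1.
have m0 : (0 < m%:R :> R)%R by rewrite ltr0n.
have em1 : (e / m%:R <= e)%R.
  by rewrite ler_pdivrMr//; apply: ler_peMr; [exact: ltW | rewrite ler1n].
have em0 : (0 < e / m%:R)%R by rewrite divr_gt0.
pose c := (1 - e / m%:R)%R.
have c01 : (0 <= c <= 1)%R by rewrite /c; apply/andP; split; lra.
have cm : (1 - e <= c ^+ m)%R.
  have := @bernoulli_ge R (e / m%:R) m; rewrite [(m%:R * _)%R]mulrC divfK ?gt_eqF//.
  by apply; apply/andP; split; lra.
exists c; split; rewrite /c; [lra|lra|exists m => //].
rewrite -/c => d X mu T f muT mf fS k n n0.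
pose j := (k %/ m)%N.
have jk : (j * m <= k)%N by exact: leq_divM.
have kj : (k - m <= m * j)%N by exact: leq_sub_mul_div.
have ej : (0 <= (1 - e) ^+ j)%R by rewrite exprn_ge0//; lra.
have mD i : measurable [set x | crossings al be (fun i => ergodic_avg F T f i x) i n].
  exact (measurable_crossing_set F _ _ muT _ _ mf).
apply: (@le_trans _ _ (mu [set x | crossings al be (fun i => ergodic_avg F T f i x) (j * m) n])).
  apply: le_measure; rewrite ?inE// => x /=; exact: crossings_leq.
have := mu_crossing_set muT F_neq0 tempR ej n0 mf fS
  (fun phi phiS => decays_iter (r := r) (j := j) (phi := phi) er phiS).
move=> /le_trans; apply; rewrite lee_fin mulrC ler_pM//; [lra|lra|].
apply: (@le_trans _ _ ((c ^+ m) ^+ j)); first by rewrite lerXn2r ?nnegrE//; lra.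
by rewrite -exprM; case/andP: c01 => c0 c1; rewrite ler_wiXn2l.
Qed.

End Exponential.

Theorem corollary1p3 (R : realType) (G : groupType)
    (G_countable : countable [set: G]) (G_amenable : amenable R G)
    (F : nat -> {fset G}) (F_folner : left_folner R F)
    (F_tempered : strongly_tempered R F)
    (alpha beta S : R) (alpha_beta : alpha < beta) (S_gt0 : 0 < S) :
  exists c0 c1 : R, [/\ 0 < c0, c0 < 1, 0 < c1 &
    forall (d : measure_display) (X : measurableType d) (mu : probability X R)
           (T : G -> X -> X) (f : X -> R),
      mp_system mu T ->
      f \in Lfun mu +oo%E ->
      ('N[mu]_+oo%E[EFin \o f] <= S%:E)%E ->
      forall N : nat,
        (mu (fluctuation_set F T f alpha beta N) <= (c1 * c0 ^+ N)%:E)%E].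
Proof.
have [e0 _ _] := decay_rate_bounds S_gt0 alpha_beta.
set e := (_ / _) in e0.
(* As [e] depends on [alpha], [beta] and [S] only, so do the tail chosen here and the constants,
   once [F] is given. *)
have [|n0 [tempL tempR]] := F_tempered (1 + e); first by rewrite ltrDl.
pose F' k := F (n0 + k)%N.
have F'0 n : F' n != fset0 by case: F_folner => + _; apply.
have [||c [c0 c1 [m m0 bound]]] := @mu_crossings_le R G F' alpha beta S F'0 S_gt0 alpha_beta.
- by move=> n; rewrite -left_tempered_past; exact: tempL.
- by move=> n; rewrite -right_tempered_past; exact: tempR.
have cn0 n : 0 < c ^+ n by rewrite exprn_gt0.
(* The denominator makes up for the [2 * n0] crossings lost in passing to the tail and for the shift
   by [m]. *)
exists c, (2 / c ^+ (2 * n0 + m)); split => //; first by rewrite divr_gt0.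
move=> d X mu T f muT; rewrite inE => /andP[/set_mem mf _] fS N.
have [g [mg gS le_g]] := mu_fluctuation_set_clamp F alpha beta muT (ltW S_gt0) mf fS.
apply: le_trans (le_g N) _.
(* The sets increase to one containing the fluctuation set, so continuity from below transfers a
   bound uniform in [n]; [n.+1] keeps the scale positive. *)
pose A n := [set x | crossings alpha beta (fun i => ergodic_avg F' T g i x)
  (2 * N - 2 * n0) n.+1].
have mA n : measurable (A n) by exact (measurable_crossing_set F' _ _ muT _ _ mg).
have A_mono : nondecreasing_seq A.
  move=> i j ij; apply/subsetPset => x; apply: crossings_mono; by rewrite ltnS.
have A_cup : fluctuation_set F T g alpha beta N `<=` \bigcup_n A n.
  move=> x /fluctuatesP[M cM]; exists M => //.
  apply: (@crossings_mono _ _ _ _ _ (M - n0)); first by lia.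
  have [le|lt] := leqP (2 * n0) (2 * N).
    apply: (@crossings_tail _ (fun i => ergodic_avg F T g i x)).
    by rewrite subnK.
  by have /eqP -> : (2 * N - 2 * n0 == 0)%N by rewrite subn_eq0 ltnW.
apply: le_trans (le_measure mu _ _ A_cup) _; rewrite ?inE.
- exact (measurable_fluctuation_set F _ _ muT _ mg).
- exact: bigcup_measurable.
apply: (cvge_to_le (nondecreasing_cvg_mu mA (bigcup_measurable (fun n _ => mA n)) A_mono)).
apply: nearW => n /=; apply: le_trans (bound _ _ _ _ _ muT mg gS _ _ _) _ => //.
rewrite lee_fin -mulrA ler_pM2l// mulrC ler_pdivlMr// -exprD.
rewrite ler_wiXn2l ?ltW//; lia.
Qed.
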